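(* Let $g_1:\mathbb{R}^n\to\mathbb{R}\cup\{+\infty\}$ be proper and lower semicontinuous, let $g_2:\mathbb{R}^n\to\mathbb{R}$ be differentiable with $L$-Lipschitz gradient, let $h:\mathbb{R}^n\to\mathbb{R}$ be convex, and let $f=g_1+g_2-h$. Suppose that $\inf_{x\in\mathbb{R}^n}f(x)>-\infty$ and $f$ is lower semicontinuous. Suppose further that $h$ is differentiable with $\nabla h$ being $L(h)$-Lipschitz continuous and that $f$ has the Kurdyka-Łojasiewicz property at any point $x\in\operatorname{dom} f$. Let $\{x^k\}$ be a sequence generated by the generalized proximal point algorithm (GPPA) for minimizing $f$ with parameter $t>L$, and let $C^*$ be the set of cluster points of $\{x^k\}$. If $C^*\ne\emptyset$, then $\{x^k\}$ converges to a critical point of $f$.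
   Context: GPPA: for a proper function $g$ and $t>0$, $\mathbf{prox}_t^{g}(x)=\operatorname{argmin}\{g(u)+\frac t2\|u-x\|^2: u\in\mathbb{R}^n\}$ (a set). A GPPA sequence for $f=g_1+g_2-h$ with parameter $t>L$ ($L$ being the Lipschitz constant of $\nabla g_2$) is any infinite sequence $\{x^k\}_{k\ge0}$ with $x^0\in\operatorname{dom} g_1=\{x: g_1(x)<+\infty\}$ such that, for each $k\ge 0$, there is $y^k\in\partial h(x^k)$ with $$x^{k+1}\in\mathbf{prox}_t^{g_1}\Big(x^k-\frac{\nabla g_2(x^k)-y^k}{t}\Big).$$ Subdifferentials: for convex $h$, $\partial h(\bar x)=\{v:\langle v,x-\bar x\rangle\le h(x)-h(\bar x)\ \forall x\}$. For a lower semicontinuous $\psi:\mathbb{R}^n\to\mathbb{R}\cup\{+\infty\}$ and $\bar x\in\operatorname{dom}\psi=\{x:\psi(x)<+\infty\}$, the Fréchet subdifferential is $\partial^F\psi(\bar x)=\{v:\liminf_{x\to\bar x}\frac{\psi(x)-\psi(\bar x)-\langle v,x-\bar x\rangle}{\|x-\bar x\|}\ge0\}$, and the limiting subdifferential is $\partial^L\psi(\bar x)=\{v:\exists\, x^k\to\bar x,\ \psi(x^k)\to\psi(\bar x),\ v^k\in\partial^F\psi(x^k),\ v^k\to v\}$; both are empty if $\bar x\notin\operatorname{dom}\psi$. Critical point: $\bar x\in\operatorname{dom} f$ is a critical point of $f=g_1+g_2-h$ if $[\partial^Lg_1(\bar x)+\nabla g_2(\bar x)]\cap\partial h(\bar x)\neq\emptyset$.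 Kurdyka-Łojasiewicz property: a lower semicontinuous $f$ has this property at $x^*\in\operatorname{dom}\partial^Lf=\{x:\partial^Lf(x)\neq\emptyset\}$ if there exist $\nu>0$, a neighborhood $\mathcal V$ of $x^*$, and a continuous concave function $\varphi:[0,\nu)\to[0,+\infty)$ such that $\varphi(0)=0$; $\varphi$ is $C^1$ on $(0,\nu)$; $\varphi'>0$ on $(0,\nu)$; and for every $x\in\mathcal V$ with $f(x^* )<f(x)<f(x^* )+\nu$ one has $\varphi'(f(x)-f(x^* ))\,\operatorname{dist}(0,\partial^Lf(x))\ge1$ (with $\operatorname{dist}(0,\emptyset)=+\infty$). *)

(* Defs.v *)
From HB Require Import structures.
From mathcomp Require Import all_boot all_order all_algebra.
From mathcomp Require Import all_classical all_reals all_analysis.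

Set Implicit Arguments.
Unset Strict Implicit.
Unset Printing Implicit Defensive.
Import Order.TTheory GRing.Theory Num.Theory.
Import numFieldNormedType.Exports.
Local Open Scope classical_set_scope.
Local Open Scope ring_scope.

Section Defs.
Context {R : realType} {n : nat}.
Local Notation V := 'rV[R]_n.

Definition dotv (u v : V) : R := \sum_(i < n) u 0 i * v 0 i.

(* The library norm `|v| on 'rV[R]_n is the sup norm; it induces the same
   topology and the same notion of differentiability, but the Lipschitz
   constants, the proximal terms and the distances below are Euclidean. *)
Definition norm2 (v : V) : R := Num.sqrt (dotv v v).

Definition grad (g : V -> R) (x : V) : V := \row_i 'D_(delta_mx 0 i) g x.

Definition lipschitz2 (L : R) (F : V -> V) : Prop :=
  0 <= L /\ forall x y, norm2 (F x - F y) <= L * norm2 (x - y).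

Local Open Scope ereal_scope.

Definition effdom (g : V -> \bar R) : set V := [set x | g x < +oo].

(* g takes values in R u {+oo} and is not identically +oo. *)
Definition proper_efun (g : V -> \bar R) : Prop :=
  (forall x, g x != -oo) /\ effdom g !=set0.

Definition dc_fun (g1 : V -> \bar R) (g2 h : V -> R) : V -> \bar R :=
  fun x => g1 x + (g2 x)%:E - (h x)%:E.

Definition prox (g : V -> \bar R) (t : R) (x : V) : set V :=
  [set u | forall w, g u + (t / 2 * norm2 (u - x) ^+ 2)%:E
                  <= g w + (t / 2 * norm2 (w - x) ^+ 2)%:E].

Definition convex_subdiff (h : V -> R) (x : V) : set V :=
  [set v | forall y, (dotv v (y - x) <= h y - h x)%R].

Definition frechet_subdiff (psi : V -> \bar R) (x : V) : set V :=
  [set v | effdom psi x /\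
     0 <= limf_einf (fun y => (psi y - psi x - (dotv v (y - x))%:E)
                              * (norm2 (y - x))^-1%:E) x^'].

Definition limiting_subdiff (psi : V -> \bar R) (x : V) : set V :=
  [set v | effdom psi x /\
     exists (xs vs : nat -> V),
       [/\ xs @ \oo --> x, psi (xs k) @[k --> \oo] --> psi x,
           (forall k, frechet_subdiff psi (xs k) (vs k)) & vs @ \oo --> v]].

Definition critical_point (g1 : V -> \bar R) (g2 h : V -> R) (x : V) : Prop :=
  effdom (dc_fun g1 g2 h) x /\
  ([set (v + grad g2 x)%R | v in limiting_subdiff g1 x]
     `&` convex_subdiff h x) !=set0.

(* dist(0, A), equal to +oo when A is empty. *)
Definition dist0 (A : set V) : \bar R := ereal_inf [set (norm2 v)%:E | v in A].

(* Only the values of phi on [0, nu[ matter; concavity of phi is convexity of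
   its opposite. *)
Definition desingularizing (nu : R) (phi : R -> R) : Prop :=
  [/\ {within `[0%R, nu[, continuous phi},
      convex_function (`[0%R, nu[ : set R) (\- phi)%R,
      (forall s, s \in `[0%R, nu[ -> (0 <= phi s)%R),
      phi 0%R = 0%R &
      forall s, s \in `]0%R, nu[ ->
        [/\ derivable phi s 1, {for s, continuous phi^`()%classic}
          & (0 < phi^`()%classic s)%R]].

Definition KL_property (f : V -> \bar R) (xstar : V) : Prop :=
  limiting_subdiff f xstar !=set0 /\
  exists (nu : R) (U : set V) (phi : R -> R),
    [/\ (0 < nu)%R, nbhs xstar U, desingularizing nu phi &
        forall x, U x -> f xstar < f x -> f x < f xstar + nu%:E ->
          1 <= (phi^`()%classic (fine (f x - f xstar)))%:E
               * dist0 (limiting_subdiff f x)].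

Definition GPPA (g1 : V -> \bar R) (g2 h : V -> R) (t : R) (x : nat -> V)
    : Prop :=
  effdom g1 (x 0%N) /\
  forall k, exists2 y, convex_subdiff h (x k) y &
    prox g1 t (x k - t^-1 *: (grad g2 (x k) - y))%R (x k.+1).

End Defs.

(* Main.v *)
Require Import Defs.
From HB Require Import structures.
From mathcomp Require Import all_boot all_order all_algebra.
From mathcomp Require Import all_classical all_reals all_analysis.
From mathcomp Require Import ring lra.

Set Implicit Arguments.
Unset Strict Implicit.
Unset Printing Implicit Defensive.
Import Order.TTheory GRing.Theory Num.Theory.
Import numFieldNormedType.Exports.
Local Open Scope classical_set_scope.
Local Open Scope ring_scope.

(* For all w, optimality of x_{k+1} in the proximal problem combined with the
   quadratic bounds on g2 and h gives
     f x_{k+1} + (t - L)/2 |x_{k+1} - x_k|^2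
       <= f w + (t + L + Lh)/2 |w - x_k|^2.
   Taking w = x_k shows that the values decrease to a limit l; taking w a
   cluster point z, together with lower semicontinuity, shows f z = l.
   Optimality also yields a subgradient of f at x_{k+1} of norm at most
   b |x_{k+1} - x_k| with b = t + L + Lh.  Writing D_k = |x_{k+1} - x_k| and
   s_k = f x_k - l, concavity of phi and the KL inequality give
     2 D_{k+1} <= D_k + c (phi s_{k+1} - phi s_{k+2}),   c = 2 b / (t - L),
   as long as x_{k+1} is close to z.  Hence the potential
     |x_{k+1} - z| + D_k + c phi s_{k+1}
   does not increase once it is small, and since z is a cluster point it becomes
   arbitrarily small: x_k converges to z. *)

(** * Euclidean inner product and norm *)

Section Euclid.
Context {R : realType} {n : nat}.
Implicit Types u v w : 'rV[R]_n.

Lemma dotvC u v : dotv u v = dotv v u.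
Proof. by apply: eq_bigr => i _; rewrite mulrC. Qed.

Lemma dotvDl u v w : dotv (u + v) w = dotv u w + dotv v w.
Proof. by rewrite -big_split; apply: eq_bigr => i _; rewrite mxE mulrDl. Qed.

Lemma dotvZl (a : R) u w : dotv (a *: u) w = a * dotv u w.
Proof. by rewrite mulr_sumr; apply: eq_bigr => i _; rewrite mxE mulrA. Qed.

Lemma dotvNl u w : dotv (- u) w = - dotv u w.
Proof. by rewrite -scaleN1r dotvZl mulN1r. Qed.

Lemma dotvBl u v w : dotv (u - v) w = dotv u w - dotv v w.
Proof. by rewrite dotvDl dotvNl. Qed.

Lemma dotvDr u v w : dotv u (v + w) = dotv u v + dotv u w.
Proof. by rewrite dotvC dotvDl !(dotvC u). Qed.

Lemma dotvZr (a : R) u w : dotv u (a *: w) = a * dotv u w.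
Proof. by rewrite dotvC dotvZl dotvC. Qed.

Lemma dotvNr u w : dotv u (- w) = - dotv u w.
Proof. by rewrite dotvC dotvNl dotvC. Qed.

Lemma dotvBr u v w : dotv u (v - w) = dotv u v - dotv u w.
Proof. by rewrite dotvDr dotvNr. Qed.

Lemma dotv0r u : dotv u 0 = 0.
Proof. by rewrite -[X in dotv u X](scale0r 0) dotvZr mul0r. Qed.

Lemma dotvv_ge0 u : 0 <= dotv u u.
Proof. by apply: sumr_ge0 => i _; rewrite -expr2 sqr_ge0. Qed.

Lemma norm2_ge0 u : 0 <= norm2 u.
Proof. exact: sqrtr_ge0. Qed.

Lemma sqr_norm2 u : norm2 u ^+ 2 = dotv u u.
Proof. by rewrite sqr_sqrtr // dotvv_ge0. Qed.

Lemma sqr_norm2D u v :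
  norm2 (u + v) ^+ 2 = norm2 u ^+ 2 + 2 * dotv u v + norm2 v ^+ 2.
Proof.
by rewrite !sqr_norm2 dotvDl !dotvDr (dotvC v u); ring.
Qed.

Lemma norm2Z (a : R) u : norm2 (a *: u) = `|a| * norm2 u.
Proof.
by rewrite /norm2 dotvZl dotvZr mulrA -expr2 sqrtrM ?sqr_ge0 // sqrtr_sqr.
Qed.

Lemma norm2_0 : norm2 (0 : 'rV[R]_n) = 0.
Proof. by rewrite -(scale0r 0) norm2Z normr0 mul0r. Qed.

Lemma norm2N u : norm2 (- u) = norm2 u.
Proof. by rewrite -scaleN1r norm2Z normrN normr1 mul1r. Qed.

Lemma norm2_distC u v : norm2 (u - v) = norm2 (v - u).
Proof. by rewrite -norm2N opprB. Qed.

Lemma norm_le_norm2 u : `|u| <= norm2 u.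
Proof.
rewrite /Num.norm /= mx_normrE; apply: bigmax_le; first exact: norm2_ge0.
move=> [i j] _ /=; rewrite (ord1 i) -sqrtr_sqr.
apply: ler_wsqrtr; rewrite /dotv (bigD1 j) //= -expr2 lerDl.
by apply: sumr_ge0 => k _; rewrite -expr2 sqr_ge0.
Qed.

Lemma norm2_eq0 u : norm2 u = 0 -> u = 0.
Proof.
by move=> u0; apply/eqP; rewrite -normr_le0 -u0; exact: norm_le_norm2.
Qed.

Lemma norm2_gt0 u : u != 0 -> 0 < norm2 u.
Proof.
move=> u0; rewrite lt_neqAle norm2_ge0 andbT eq_sym.
by apply: contra u0 => /eqP/norm2_eq0->.
Qed.

(** Cauchy-Schwarz: the square of [norm2 v *: u - norm2 u *: v] expands to 2|u||v|(|u||v| - <u,v>).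
    Zero vectors are set apart so that the positive factor can be cancelled. *)
Lemma dotv_le_norm2 u v : dotv u v <= norm2 u * norm2 v.
Proof.
have [->|v0] := eqVneq v 0.
  by rewrite dotv0r mulr_ge0 ?norm2_ge0.
have nv := norm2_gt0 v0.
have := dotvv_ge0 (norm2 v *: u - norm2 u *: v).
rewrite dotvBl !dotvBr !dotvZl !dotvZr -!sqr_norm2 (dotvC v u).
have [->|u0] := eqVneq u 0.
  by rewrite dotvC dotv0r mulr_ge0 ?norm2_ge0.
have nu := norm2_gt0 u0.
move=> H; have H2 : 0 <= (norm2 u * norm2 v) * (norm2 u * norm2 v - dotv u v).
  by nra.
by move: H2; rewrite pmulr_rge0 ?mulr_gt0 // subr_ge0.
Qed.

Lemma ler_norm2D u v : norm2 (u + v) <= norm2 u + norm2 v.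
Proof.
rewrite -(@ler_pXn2r _ 2) ?nnegrE ?addr_ge0 ?norm2_ge0 //.
rewrite sqr_norm2D.
by have := dotv_le_norm2 u v; lra.
Qed.

(** The sharp constant is sqrt n; the cruder n, from n <= n^2, already gives equivalence of the two
    norms. *)
Lemma norm2_le_norm u : norm2 u <= n%:R * `|u|.
Proof.
have h0 : 0 <= n%:R * `|u| by rewrite mulr_ge0.
rewrite -(@ler_pXn2r _ 2) ?nnegrE ?norm2_ge0 // sqr_norm2.
apply: (@le_trans _ _ (\sum_(i < n) `|u| ^+ 2)).
  apply: ler_sum => i _; rewrite -expr2 -real_normK ?num_real //.
  rewrite ler_pXn2r ?nnegrE //.
  rewrite [leRHS]/Num.norm /= mx_normrE.
  exact: (le_bigmax _ (fun ij : 'I_1 * 'I_n => `|u ij.1 ij.2|) (0, i)).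
rewrite sumr_const card_ord exprMn -[leLHS]mulr_natl ler_wpM2r ?sqr_ge0 //.
by rewrite -natrX ler_nat; case: (n) => // m; rewrite leq_pmulr.
Qed.

End Euclid.

(** * The topology expressed through the Euclidean norm *)

Section EuclidTopology.
Context {R : realType} {n : nat}.
Implicit Types x y : 'rV[R]_n.

Lemma near_norm2_lt x (r : R) : 0 < r -> \forall y \near x, norm2 (y - x) < r.
Proof.
move=> r0; apply/nbhs_normP; exists (r / n.+1%:R) => /=.
  by rewrite divr_gt0.
move=> y /=; rewrite ltr_pdivlMr // => yr.
rewrite norm2_distC (le_lt_trans (norm2_le_norm _)) // mulrC.
by rewrite (le_lt_trans _ yr) // ler_wpM2l // ler_nat.
Qed.

Lemma nbhs_norm2 x (U : set 'rV[R]_n) :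
  nbhs x U -> exists2 r : R, 0 < r & forall y, norm2 (y - x) < r -> U y.
Proof.
move=> /nbhs_normP[r /= r0 rU]; exists r => // y yr; apply: rU => /=.
by rewrite distrC (le_lt_trans (norm_le_norm2 _)).
Qed.

Lemma cvg_norm2P T (F : set_system T) {FF : Filter F} (xs : T -> 'rV[R]_n) x :
  xs @ F --> x <-> forall r, 0 < r -> \forall k \near F, norm2 (xs k - x) < r.
Proof.
split=> [xsx r r0|H U /nbhs_norm2[r r0 rU]].
  exact: (xsx _ (near_norm2_lt x r0)).
by apply: filterS (H r r0) => k; exact: rU.
Qed.

Lemma lipschitz2_continuous (L : R) (F : 'rV[R]_n -> 'rV[R]_n) :
  lipschitz2 L F -> continuous F.
Proof.
move=> [L0 FL] x; apply/(cvg_norm2P (F := nbhs x)) => r r0.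
have L1 : 0 < L + 1 by lra.
apply: filterS (near_norm2_lt x (divr_gt0 r0 L1)) => y.
rewrite ltr_pdivlMr // => yr.
rewrite (le_lt_trans (FL _ _)) // (le_lt_trans _ yr) // mulrC.
by rewrite ler_wpM2l ?norm2_ge0 ?lerDl.
Qed.

Lemma cvg_dotv T (F : set_system T) {FF : Filter F}
    (us vs : T -> 'rV[R]_n) u v :
  us @ F --> u -> vs @ F --> v -> dotv (us k) (vs k) @[k --> F] --> dotv u v.
Proof.
move=> usu vsv; rewrite /dotv; apply: cvg_big => [|i _].
  exact: add_continuous.
apply: cvgM.
  exact: (cvg_comp _ _ usu (@coord_continuous _ _ _ 0 i u)).
exact: (cvg_comp _ _ vsv (@coord_continuous _ _ _ 0 i v)).
Qed.

End EuclidTopology.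

(** * Directional derivatives, gradients and quadratic bounds *)

Section Gradient.
Context {R : realType} {n : nat}.
Implicit Types (g : 'rV[R]_n -> R) (x y v : 'rV[R]_n).

(** A derivable function has its derivative as a one-sided limit too, so bounding the quotients for
    r > 0 suffices; convexity and subgradient inequalities give exactly that. *)
Lemma derive_ge (V : normedModType R) (f : V -> R) (x v : V) (c : R) :
  derivable f x v -> (\forall r \near 0^'+, c * r <= f (r *: v + x) - f x) ->
  c <= 'D_v f x.
Proof.
move=> dfx cf; rewrite /derive cvg_at_rightE //; apply: limr_ge.
  by apply: cvgP; apply: cvg_dnbhs_at_right; exact: dfx.
near=> r; rewrite /= -[_ *: _]/(r^-1 * _) mulrC ler_pdivlMr; near: r => //.
exact: nbhs_right_gt.
Unshelve. all: by end_near. Qed.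

Lemma derive_grad g x v : differentiable g x -> 'D_v g x = dotv (grad g x) v.
Proof.
move=> dg; rewrite deriveE // [v in LHS]row_sum_delta linear_sum.
by apply: eq_bigr => i _; rewrite linearZ /= mxE mulrC deriveE.
Qed.

(** With d = v - grad g x, the subgradient inequality along x + r d gives <v,d> <= <grad g x,d>,
    that is |d|^2 <= 0. *)
Lemma convex_subdiff_grad g x v :
  differentiable g x -> convex_subdiff g x v -> v = grad g x.
Proof.
move=> dg vg; apply/eqP; rewrite -subr_eq0; apply/eqP/norm2_eq0/eqP.
rewrite -sqrf_eq0 eq_le sqr_ge0 andbT sqr_norm2 dotvBl subr_le0.
rewrite -derive_grad //; apply: derive_ge; first exact: diff_derivable.
by near=> r; rewrite (le_trans _ (vg _)) // addrK dotvZr mulrC.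
Unshelve. all: by end_near. Qed.

Lemma grad_near g x (e : R) : differentiable g x -> 0 < e ->
  \forall y \near x,
    `|g y - g x - dotv (grad g x) (y - x)| <= e * norm2 (y - x).
Proof.
move=> dg e0; rewrite (near_shift 0 x) subr0.
have /eqaddoP/(_ e e0) := diff_locally dg; apply: filterS => y.
rewrite /= addrK -derive_grad // deriveE // -addrA -opprD => /le_trans; apply.
by rewrite ler_wpM2l ?norm_le_norm2 // ltW.
Qed.

Lemma is_derive_line g x v (s : R) : differentiable g (x + s *: v) ->
  is_derive s 1 (fun r => g (x + r *: v)) (dotv (grad g (x + s *: v)) v).
Proof.
move=> dg; rewrite -derive_grad //.
have E : (fun r : R => r^-1 *: (((fun r => g (x + r *: v)) \o shift s) (r *: 1)
      - g (x + s *: v))) =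
    (fun r => r^-1 *: ((g \o shift (x + s *: v)) (r *: v) - g (x + s *: v))).
  apply/funext => r /=; congr (_ *: (g _ - _)).
  by rewrite [r *: 1]mulr1 scalerDl addrCA.
apply: DeriveDef; last by rewrite /derive E.
by rewrite /derivable E; exact: diff_derivable.
Qed.

(** Monotonicity replaces integration of q': the function p below has nonpositive derivative on ]0,
    1[, hence p 1 <= p 0. *)
Lemma le_quadratic_of_derive (q dq : R -> R) (K : R) :
  (forall s : R, is_derive s 1 q (dq s)) ->
  (forall s, 0 <= s -> dq s - dq 0 <= K * s) -> q 1 - q 0 - dq 0 <= K / 2.
Proof.
move=> qdq dqK; pose p := q - dq 0 *: id - (K / 2) *: (id ^+ 2).
have dp (s : R) : is_derive s 1 p (dq s - dq 0 - K * s).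
  have H := qdq s; apply: is_derive_eq.
  rewrite /= -[_ *: _]/(_ * _) -[_ *: (_ *: _)]/(_ * (_ * _)).
  by lra.
have pc : {within `[0, 1], continuous p}.
  by apply: derivable_within_continuous => r _; exact: ex_derive.
have dp_le0 (r : R) : r \in `]0, 1[ -> p^`()%classic r <= 0.
  rewrite in_itv /= => /andP[r0 _].
  rewrite derive1E (@derive_val _ _ _ _ _ _ _ (dp r)).
  by have := dqK r (ltW r0); lra.
have dpx (r : R) : r \in `]0, 1[ -> derivable p r 1.
  by move=> _; exact: ex_derive.
have := ler0_derive1_le_cc dpx dp_le0 pc (x := 1) (y := 0).
rewrite !in_itv /= !lexx !ler01 => /(_ isT isT isT).
by rewrite /p !fctE /= -![_ *: _]/(_ * _); lra.
Qed.

(** Restrict g to the segment from x to y. The one-variable bound with K = L |y - x|^2, applied to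
    this restriction and to its opposite, gives the two sides. *)
Lemma lipschitz_grad_quadratic g (L : R) :
  (forall z, differentiable g z) -> lipschitz2 L (grad g) ->
  forall x y,
    `|g y - g x - dotv (grad g x) (y - x)| <= L / 2 * norm2 (y - x) ^+ 2.
Proof.
move=> dg [L0 gL] x y; set v := y - x.
have K s : 0 <= s ->
    `|dotv (grad g (x + s *: v)) v - dotv (grad g (x + 0 *: v)) v|
      <= L * norm2 v ^+ 2 * s.
  move=> s0; rewrite -dotvBl scale0r addr0.
  have Lv : norm2 (grad g (x + s *: v) - grad g x) * norm2 v <=
      L * norm2 v ^+ 2 * s.
    rewrite expr2 mulrA mulrAC ler_wpM2r ?norm2_ge0 //.
    rewrite (le_trans (gL _ _)) // addrC addKr norm2Z ger0_norm //.
    by rewrite mulrCA mulrC.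
  rewrite ler_norml lerNl -dotvNl; apply/andP; split.
    by rewrite (le_trans (dotv_le_norm2 _ _)) // norm2N.
  by rewrite (le_trans (dotv_le_norm2 _ _)).
have dl s := is_derive_line (dg (x + s *: v)).
have E : g y - g x - dotv (grad g x) v =
    g (x + 1 *: v) - g (x + 0 *: v) - dotv (grad g (x + 0 *: v)) v.
  by rewrite scale1r scale0r addr0 /v [x + (y - x)]addrC subrK.
rewrite E mulrAC ler_norml lerNl; apply/andP; split; last first.
  apply: (le_quadratic_of_derive dl) => s s0.
  exact: le_trans (ler_norm _) (K s s0).
have := @le_quadratic_of_derive (fun s => - g (x + s *: v)) _ (L * norm2 v ^+ 2)
  (fun s => is_deriveN (dl s)).
rewrite !opprD !opprK; apply => s s0.
by rewrite addrC (le_trans (ler_norm _)) // distrC K.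
Qed.

End Gradient.

(** Trades the extended-real liminf of quotients for an epsilon inequality without division, in
    which error terms can be added. *)
Lemma frechet_subdiff_intro {R : realType} {n : nat} (psi : 'rV[R]_n -> \bar R)
    (x v : 'rV[R]_n) : psi x \is a fin_num ->
  (forall e : R, 0 < e -> \forall y \near x,
     (psi x + (dotv v (y - x) - e * norm2 (y - x))%:E <= psi y)%E) ->
  frechet_subdiff psi x v.
Proof.
move=> psix H; split; first by rewrite /effdom /= ltey_eq psix.
rewrite limf_einfE; apply/lee_addgt0Pr => e e0.
rewrite -leeBlDr // sub0e; apply: le_trans (ereal_sup_ubound _); last first.
  exists [set y | y != x /\
    (psi x + (dotv v (y - x) - e * norm2 (y - x))%:E <= psi y)%E] => //.
  by apply: filterS (H e e0) => y Hy yx; split.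
apply: le_ereal_inf_tmp => _ [y [yx +] <-].
have r0 : 0 < norm2 (y - x) by rewrite norm2_gt0 // subr_eq0.
(* If psi y = +oo the quotient is +oo, because the inverse norm is positive; psi y = -oo contradicts
   the lower bound. *)
move: psix; case: (psi x) => // a _; case: (psi y) => [b||] //.
  rewrite -!EFinN -!EFinD -EFinM !lee_fin => ab.
  by rewrite ler_pdivlMr //; lra.
by move=> _ /=; rewrite gt0_mulye ?leey // lte_fin invr_gt0.
Qed.

(** * Desingularizing functions *)

Section Desingularizing.
Context {R : realType} {nu : R} {phi : R -> R}.
Hypothesis phiP : desingularizing nu phi.

(** A concave graph lies below its tangent at s: by concavity the chord slope towards s' bounds from
    below the quotients in direction s' - s. The value s' = 0 is allowed, as the gap may vanish at
    the next iterate. *)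
Lemma desingularizing_slope (s s' : R) : 0 < s < nu -> 0 <= s' < nu ->
  phi s' - phi s <= phi^`()%classic s * (s' - s).
Proof.
case: phiP => _ phi_concave _ _ phi_d /andP[s0 snu] /andP[s'0 s'nu].
have /phi_d[dphi _ _] : s \in `]0, nu[ by rewrite in_itv /= s0.
have -> : phi^`()%classic s * (s' - s) = 'D_(s' - s) phi s.
  move/derivable1_diffP : (dphi) => ddphi.
  by rewrite derive1E !deriveE // -[in RHS](mulr1 (s' - s)) linearZ mulrC.
apply: derive_ge; first exact/diff_derivable/derivable1_diffP.
near=> r.
have r0 : 0 <= r by near: r; exact: nbhs_right_ge.
have r1 : r <= 1 by near: r; exact: nbhs_right_le.
have := phi_concave (Itv01 r0 r1) s' s.
rewrite !mem_setE !in_itv /= s'0 s'nu snu (ltW s0) => /(_ isT isT).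
rewrite !convRE /= /unstable.onem.
set z := conv _ _ _; have -> : z = r *: (s' - s) + s.
  by rewrite -[z]/(r * s' + (1 - r) * s) -[_ *: _]/(_ * _); ring.
by lra.
Unshelve. all: by end_near. Qed.

Lemma desingularizing_small (e : R) : 0 < nu -> 0 < e ->
  \forall s \near 0, 0 <= s -> phi s < e.
Proof.
move=> nu0 e0; case: phiP => phic _ _ phi0 _.
have z : 0 \in `[0, nu[ by rewrite in_itv /= lexx.
have /subspace_continuousP/(_ 0) := phic.
move=> /(_ z); rewrite /from_subspace phi0 => /cvgrPdist_lt/(_ e e0).
rewrite near_withinE => H.
near=> s => s0.
have snu : s < nu by near: s; exact: lt_nbhsl.
have : s \in `[0, nu[ -> `|0 - phi s| < e by near: s.
rewrite in_itv /= s0 snu sub0r normrN => /(_ isT).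
by apply: le_lt_trans; exact: ler_norm.
Unshelve. all: by end_near. Qed.

End Desingularizing.

(** Convergence separated from the algorithm: [s] is the gap in value, [a] the rate of sufficient
    decrease, and [b] bounds a subgradient by the last step. The KL hypothesis holds only in a ball,
    so the iterates must be shown to stay there. *)
Lemma kl_cvg {R : realType} {n : nat} (x : nat -> 'rV[R]_n) (xs : 'rV[R]_n)
    (s : nat -> R) (a b nu r : R) (phi : R -> R) :
  0 < a -> 0 < b -> 0 < nu -> 0 < r -> desingularizing nu phi ->
  (forall k, 0 <= s k) -> s @ \oo --> 0 ->
  (forall k, s k.+1 + a * norm2 (x k.+1 - x k) ^+ 2 <= s k) ->
  (forall k, norm2 (x k.+1 - xs) < r -> 0 < s k.+1 < nu ->
     1 <= phi^`()%classic (s k.+1) * (b * norm2 (x k.+1 - x k))) ->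
  cluster (x @ \oo) xs -> x @ \oo --> xs.
Proof.
move=> a0 b0 nu0 r0 phiP s_ge0 s_cvg s_dec s_KL x_cluster.
have [_ _ phi_ge0 phi0 _] := phiP.
pose D k := norm2 (x k.+1 - x k); pose c := b / a.
have c0 : 0 < c by rewrite divr_gt0.
have D0 k : 0 <= D k := norm2_ge0 _.
have ltD e : 0 < e -> \forall k \near \oo, D k < e.
  move=> e0; have ae0 : 0 < a * e ^+ 2 by rewrite mulr_gt0 ?exprn_gt0.
  apply: filterS (cvgr_lt _ s_cvg _ ae0) => k sk.
  rewrite -(@ltr_pXn2r _ 2) ?nnegrE ?(ltW e0) // -(ltr_pM2l a0).
  by rewrite (le_lt_trans _ sk) // (le_trans _ (s_dec k)) // lerDr.
have step k : norm2 (x k.+1 - xs) < r -> s k.+1 < nu ->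
    2 * D k.+1 <= D k + c * (phi (s k.+1) - phi (s k.+2)).
  move=> xr snu; have dec := s_dec k.+1; rewrite -/(D k.+1) in dec.
  have aD : 0 <= a * D k.+1 ^+ 2 by rewrite mulr_ge0 ?sqr_ge0 // ltW.
  have s2 := s_ge0 k.+2; have := s_ge0 k.+1.
  (* At zero gap the KL inequality says nothing, but then the next gap and the next step both
     vanish. *)
  rewrite le_eqVlt => /orP[/eqP s1|s1].
    have -> : s k.+2 = s k.+1 by lra.
    have : a * D k.+1 ^+ 2 == 0 by rewrite eq_le aD; lra.
    rewrite mulf_eq0 (gt_eqF a0) /= sqrf_eq0 => /eqP ->.
    by rewrite subrr !mulr0 addr0.
  have sl : phi (s k.+2) - phi (s k.+1) <=
      phi^`()%classic (s k.+1) * (s k.+2 - s k.+1).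
    by apply: (desingularizing_slope phiP); rewrite ?s1 // s2; lra.
  have := s_KL k xr; rewrite s1 snu -/(D k) => /(_ isT) KL.
  have d0 : 0 < phi^`()%classic (s k.+1).
    by case: phiP => _ _ _ _ /(_ (s k.+1)) []//; rewrite in_itv /= s1.
  set p := phi^`()%classic _ in sl KL d0; set Delta := phi _ - phi _.
  have De : p * (a * D k.+1 ^+ 2) <= Delta by rewrite /Delta; nra.
  have bD : 0 <= b * D k by rewrite mulr_ge0 // ltW.
  have De0 : 0 <= Delta by apply: le_trans De; rewrite mulr_ge0 // ltW.
  (* Multiply [De] by b D_k and bound the factor p (b D_k) below by 1, using KL. *)
  have DD : D k.+1 ^+ 2 <= c * D k * Delta.
    rewrite /c -(ler_pM2l a0).
    have -> : a * (b / a * D k * Delta) = (b * D k) * Delta by field; lra.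
    apply: le_trans (ler_wpM2l bD De).
    have -> : b * D k * (p * (a * D k.+1 ^+ 2)) =
      (p * (b * D k)) * (a * D k.+1 ^+ 2) by ring.
    by rewrite ler_peMl.
  have cDe : 0 <= c * Delta by rewrite mulr_ge0 // ltW.
  rewrite -(@ler_pXn2r _ 2) ?nnegrE ?addr_ge0 //; last by rewrite mulr_ge0.
  (* AM-GM: 4 D_(k+1)^2 <= 4 D_k (c Delta) <= (D_k + c Delta)^2 *)
  by have := sqr_ge0 (D k - c * Delta); nra.
pose Q k := norm2 (x k.+1 - xs) + D k + c * phi (s k.+1).
have s_nu : \forall k \near \oo, s k.+1 < nu.
  by apply: (@cvgr_lt _ _ _ _ _ 0) => //; rewrite cvg_shiftS.
have [K _ Knu] := s_nu.
have phis0 k : (K <= k)%N -> 0 <= c * phi (s k.+1).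
  move=> Kk; rewrite mulr_ge0 // ?(ltW c0) // phi_ge0 //.
  by rewrite in_itv /= s_ge0; exact: Knu.
have Qx k : (K <= k)%N -> norm2 (x k.+1 - xs) <= Q k.
  by move=> Kk; have := phis0 k Kk; have := D0 k; rewrite /Q; lra.
have Qdec k : (K <= k)%N -> Q k < r -> Q k.+1 <= Q k.
  move=> Kk Qr; have := step k (le_lt_trans (Qx k Kk) Qr) (Knu _ Kk).
  have := ler_norm2D (x k.+2 - x k.+1) (x k.+1 - xs).
  by rewrite addrA subrK -/(D k.+1) /Q; lra.
(* Being below e gives the convergence estimate; being below r keeps the iterates in the KL ball. *)
apply/cvg_norm2P => e e0; pose e' := Num.min e r.
have e'0 : 0 < e' by rewrite lt_min e0.
have e'3 : 0 < e' / 3 by rewrite divr_gt0.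
have [N /= KN QN] : exists2 N, (K <= N)%N & Q N < e'.
  have : \forall k \near \oo, phi (s k) < e' / 3 / c.
    have H := s_cvg _ (desingularizing_small phiP nu0 (divr_gt0 e'3 c0)).
    by apply: (filterS _ (H : \oo _)) => k /(_ (s_ge0 k)).
  move=> [K1 _ K1s].
  have [K2 _ K2D] := ltD _ e'3.
  (* Each of the three terms of Q gets e'/3. Two are small for all large indices; the distance to xs
     is small only at the visits granted by the cluster point. Since [Q k] involves [x k.+1], a
     visit at index k + 1 gives N = k. *)
  have [M _ HM] : exists2 M, True & forall k, (M < k)%N ->
      (exists2 N, (K <= N)%N & Q N < e') \/ ~ norm2 (x k - xs) < e' / 3.
    exists (maxn K (maxn K1 K2)) => // -[//|k]; rewrite ltnS !geq_max.
    move=> /and3P[k0 k1 k2].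
    have [xk|] := boolP (norm2 (x k.+1 - xs) < e' / 3); last first.
      by move/negP; right.
    left; exists k => //; have /= := K1s k.+1 (leqW k1); rewrite ltr_pdivlMr //.
    by have /= := K2D k k2; rewrite /Q mulrC; lra.
  have [|_ [[k /= Mk <-] xk]] := x_cluster (x @` [set k | (M < k)%N]) _ _
    (near_norm2_lt xs e'3).
    by exists M.+1 => // k /= Mk; exists k.
  by case: (HM _ Mk).
exists N.+1 => // k /=; case: k => [//|k]; rewrite ltnS => Nk.
(* The induction also carries Q < r, the condition under which Q decreases once more. *)
have : Q k <= Q N.
  rewrite -(subnK Nk); elim: (k - N)%N => [//|m IH]; rewrite addSn.
  apply: (le_trans _ IH); apply: Qdec.
    by rewrite (leq_trans KN) // leq_addl.
  by rewrite (le_lt_trans IH) // (lt_le_trans QN) // ge_min lexx orbT.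
move=> Qk; rewrite (le_lt_trans (Qx k (leq_trans KN Nk))) //.
by rewrite (le_lt_trans Qk) // (lt_le_trans QN) // ge_min lexx.
Qed.

(** * Optimality in the proximal problem and the subgradients it yields *)

Section Prox.
Context {R : realType} {n : nat} (g : 'rV[R]_n -> \bar R) (t : R).
Implicit Types x c u w : 'rV[R]_n.

(** Completing the square: moving the linear term out of the centre changes the objective by a
    constant |c|^2/(2t), which cancels. *)
Lemma prox_shift_le x c u : t != 0 -> prox g t (x - t^-1 *: c) u ->
  forall w, (g u + (t / 2 * norm2 (u - x) ^+ 2 + dotv c (u - x))%:E <=
             g w + (t / 2 * norm2 (w - x) ^+ 2 + dotv c (w - x))%:E)%E.
Proof.
move=> t0 + w => /(_ w).
have E z : t / 2 * norm2 (z - (x - t^-1 *: c)) ^+ 2 =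
    (t / 2 * norm2 (z - x) ^+ 2 + dotv c (z - x)) + dotv c c / (2 * t).
  have -> : z - (x - t^-1 *: c) = (z - x) + t^-1 *: c.
    by rewrite opprB addrA addrAC.
  rewrite sqr_norm2D norm2Z exprMn real_normK ?num_real // dotvZr.
  by rewrite (dotvC (z - x) c) -sqr_norm2; field.
by rewrite !E ![((_ + _) + _ / _)%:E]EFinD !addeA leeD2rE.
Qed.

(** Expanding around u leaves only the error t/2 |y - u|^2, which is at most e |y - u| once |y - u|
    < e/t. This is the input form of [frechet_subdiff_intro] and [frechet_subdiff_dc]. *)
Lemma prox_shift_near x c u : 0 < t -> prox g t (x - t^-1 *: c) u ->
  forall e, 0 < e -> \forall y \near u,
    (g u + (dotv (- (t *: (u - x) + c)) (y - u) - e * norm2 (y - u))%:E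
      <= g y)%E.
Proof.
move=> t0 up e e0; apply: filterS (near_norm2_lt u (divr_gt0 e0 t0)) => y.
rewrite ltr_pdivlMr // => yu.
have := prox_shift_le (lt0r_neq0 t0) up y.
set A := t / 2 * _ + dotv c (u - x); set B := _ + dotv c (y - x).
set C := dotv _ _ - _ => H.
suff CAB : C <= A - B.
  rewrite (@le_trans _ _ (g u + (A - B)%:E)%E) ?leeD2l ?lee_fin //.
  by rewrite EFinB addeA leeBlDr.
rewrite /A /B /C; have -> : y - x = (y - u) + (u - x) by rewrite addrA subrK.
rewrite (sqr_norm2D (y - u)) (dotvDr c (y - u)) (dotvC (y - u)).
rewrite dotvNl (dotvDl (t *: _)) dotvZl.
by have := norm2_ge0 (y - u); nra.
Qed.

End Prox.

Lemma dc_fun_EFin {R : realType} {n : nat} (g1 : 'rV[R]_n -> \bar R)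
    (g2 h : 'rV[R]_n -> R) (w : 'rV[R]_n) :
  g1 w \is a fin_num -> dc_fun g1 g2 h w = (fine (g1 w) + g2 w - h w)%:E.
Proof. by rewrite /dc_fun; case: (g1 w). Qed.

(** Differentiable terms have two-sided first-order expansions, so h can be subtracted as well as g2
    added; each of the three terms takes e/3 of the error. *)
Lemma frechet_subdiff_dc {R : realType} {n : nat} (g1 : 'rV[R]_n -> \bar R)
    (g2 h : 'rV[R]_n -> R) (u v : 'rV[R]_n) :
  g1 u \is a fin_num -> differentiable g2 u -> differentiable h u ->
  (forall e : R, 0 < e -> \forall y \near u,
     (g1 u + (dotv v (y - u) - e * norm2 (y - u))%:E <= g1 y)%E) ->
  frechet_subdiff (dc_fun g1 g2 h) u (v + grad g2 u - grad h u).
Proof.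
move=> g1u dg2 dh H; apply: frechet_subdiff_intro => [|e e0].
  by rewrite dc_fun_EFin.
have e3 : 0 < e / 3 by rewrite divr_gt0.
apply: filterS3 (H _ e3) (grad_near dg2 e3) (grad_near dh e3) => y.
rewrite dc_fun_EFin // /dc_fun -{1}(fineK g1u).
case: (g1 y) => [b||]; [|by move=> *; rewrite /= leey|by rewrite leeNy_eq].
rewrite -!EFinD !lee_fin dotvBl dotvDl !ler_norml.
by move=> ? /andP[? ?] /andP[? ?]; lra.
Qed.

Lemma frechet_subdiff_limiting {R : realType} {n : nat}
    (psi : 'rV[R]_n -> \bar R) (x : 'rV[R]_n) :
  frechet_subdiff psi x `<=` limiting_subdiff psi x.
Proof.
move=> v vx; split; first by case: vx.
by exists (fun=> x), (fun=> v); split=> //; exact: cvg_cst.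
Qed.

(** * The iterates of the algorithm *)

Section GPPA.
Context {R : realType} {n : nat}.
Variables (g1 : 'rV[R]_n -> \bar R) (g2 h : 'rV[R]_n -> R) (L Lh t : R).
Variable x : nat -> 'rV[R]_n.
Hypotheses (g1_proper : proper_efun g1)
  (g2_diff : forall z, differentiable g2 z) (g2_lip : lipschitz2 L (grad g2))
  (h_diff : forall z, differentiable h z) (h_lip : lipschitz2 Lh (grad h))
  (tL : L < t) (x_GPPA : GPPA g1 g2 h t x).
Local Notation f := (dc_fun g1 g2 h).

Let t_gt0 : 0 < t.
Proof. by case: g2_lip => L0 _; exact: le_lt_trans tL. Qed.

Lemma GPPA_subdiff k : convex_subdiff h (x k) (grad h (x k)).
Proof.
case: x_GPPA => _ /(_ k)[y hy _].
by rewrite -(convex_subdiff_grad (h_diff _) hy).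
Qed.

Lemma GPPA_prox k :
  prox g1 t (x k - t^-1 *: (grad g2 (x k) - grad h (x k))) (x k.+1).
Proof.
by case: x_GPPA => _ /(_ k)[y hy]; rewrite -(convex_subdiff_grad (h_diff _) hy).
Qed.

(** Every later iterate is compared directly with x_0 in its own proximal problem, where x_0 has
    finite value. *)
Lemma GPPA_fin_num k : g1 (x k) \is a fin_num.
Proof.
have [g1Ny _] := g1_proper; have [x0 _] := x_GPPA.
rewrite fin_numE g1Ny /=; case: k => [|k]; first by rewrite -ltey.
have := prox_shift_le (lt0r_neq0 t_gt0) (GPPA_prox k) (x 0%N).
apply: contraTN => /eqP ->; rewrite addye // leye_eq.
by move: x0; rewrite /effdom /=; case: (g1 (x 0%N)).
Qed.

(** At x_{k+1} the subgradient inequality bounds h below without quadratic loss, so only L is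
    subtracted from t on the left. At w, h is bounded above through its Lipschitz gradient, which
    puts Lh on the right. *)
Lemma GPPA_descent k w :
  (f (x k.+1) + ((t - L) / 2 * norm2 (x k.+1 - x k) ^+ 2)%:E <=
   f w + ((t + L + Lh) / 2 * norm2 (w - x k) ^+ 2)%:E)%E.
Proof.
have := prox_shift_le (lt0r_neq0 t_gt0) (GPPA_prox k) w.
rewrite dc_fun_EFin ?GPPA_fin_num // -{1}(fineK (GPPA_fin_num k.+1)) /dc_fun.
case: (g1 w) (g1_proper.1 w) => [b||] // _; last by move=> _; rewrite /= leey.
rewrite -!EFinD !lee_fin !dotvBl => H.
have := GPPA_subdiff k (x k.+1).
have /ler_normlP[] := lipschitz_grad_quadratic g2_diff g2_lip (x k) (x k.+1).
have /ler_normlP[] := lipschitz_grad_quadratic g2_diff g2_lip (x k) w.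
have /ler_normlP[] := lipschitz_grad_quadratic h_diff h_lip (x k) w.
lra.
Qed.

Lemma GPPA_frechet_g1 k : frechet_subdiff g1 (x k.+1)
  (- (t *: (x k.+1 - x k) + (grad g2 (x k) - grad h (x k)))).
Proof.
apply: frechet_subdiff_intro (GPPA_fin_num _) _.
exact: prox_shift_near (GPPA_prox k).
Qed.

Lemma GPPA_subgradient k : exists2 v, limiting_subdiff f (x k.+1) v &
  norm2 v <= (t + L + Lh) * norm2 (x k.+1 - x k).
Proof.
set v0 := - (t *: (x k.+1 - x k) + (grad g2 (x k) - grad h (x k))).
exists (v0 + grad g2 (x k.+1) - grad h (x k.+1)).
  apply: frechet_subdiff_limiting; apply: frechet_subdiff_dc => //.
    exact: GPPA_fin_num.
  exact: prox_shift_near (GPPA_prox k).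
(* Regrouped into three increments, of norm at most t, L and Lh times the step. *)
have -> : v0 + grad g2 (x k.+1) - grad h (x k.+1) = - t *: (x k.+1 - x k) +
    (grad g2 (x k.+1) - grad g2 (x k)) + (grad h (x k) - grad h (x k.+1)).
  by apply/rowP => i; rewrite /v0 !mxE; ring.
apply: le_trans (ler_norm2D _ _) _; rewrite 2!mulrDl lerD //; last first.
  by rewrite norm2_distC; exact: h_lip.2.
apply: le_trans (ler_norm2D _ _) _; rewrite lerD //; last exact: g2_lip.2.
by rewrite norm2Z normrN gtr0_norm.
Qed.

Hypotheses (f_inf : (-oo < ereal_inf (range f))%E)
  (f_lsc : lower_semicontinuous f).

Lemma GPPA_value_cvg : exists l : R,
  [/\ (fun k => fine (f (x k))) @ \oo --> l,
      forall k, l <= fine (f (x k)) &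
      forall z, cluster (x @ \oo) z -> f z = l%:E].
Proof.
pose F k := fine (f (x k)).
have FE k : f (x k) = (F k)%:E by rewrite fineK // dc_fun_EFin ?GPPA_fin_num.
have F_noninc : nonincreasing_seq F.
  apply/nonincreasing_seqP => k; have := GPPA_descent k (x k).
  rewrite subrr norm2_0 expr0n mulr0 adde0 !FE lee_fin; apply: le_trans.
  by rewrite lerDl mulr_ge0 ?sqr_ge0 // divr_ge0 // subr_ge0 ltW.
have F_lb : has_lbound (range F).
  case E : (ereal_inf (range f)) f_inf => [m||] // _.
    exists m => _ [k _ <-]; rewrite -lee_fin -FE -E.
    by apply: ereal_inf_lbound; exists (x k).
  (* The infimum cannot be +oo, since f is finite at x_0. *)
  have : (ereal_inf (range f) <= f (x 0%N))%E.
    by apply: ereal_inf_lbound; exists (x 0%N).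
  by rewrite E FE.
have F_cvg := nonincreasing_is_cvgn F_noninc F_lb.
have F_ge := nonincreasing_cvgn_ge F_noninc F_cvg.
exists (limn F); split=> // z z_cluster.
have visit U N : nbhs z U -> exists2 k, (N <= k)%N & U (x k).
  move=> zU; have [|_ [[k /= Nk <-] xk]] :=
    z_cluster (x @` [set k | (N <= k)%N]) _ _ zU.
    by exists N => // k /= Nk; exists k.
  by exists k.
apply/eqP; rewrite eq_le; apply/andP; split.
  (* Lower semicontinuity gives f z <= l: otherwise f exceeds some r > l near z, while the values at
     late visits are below r. *)
  rewrite leNgt; apply/negP => lz.
  have [r lr rz] : exists2 r : R, limn F < r & (r%:E < f z)%E.
    case: (f z) lz => [b||] //.
      rewrite lte_fin => lb.
      by exists ((limn F + b) / 2); rewrite ?lte_fin; lra.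
    by move=> _; exists (limn F + 1); rewrite ?ltey // ltrDl.
  have [U zU Ur] := f_lsc rz.
  have [N _ NF] := cvgr_lt _ F_cvg _ lr.
  have [k Nk /Ur] := visit U N zU.
  by rewrite FE lte_fin ltNge ltW //; exact: NF.
have [L0 _] := g2_lip; have [Lh0 _] := h_lip; have t0 := t_gt0.
have C0 : 0 < (t + L + Lh) / 2 by lra.
have K0 : 0 <= (t - L) / 2 by rewrite divr_ge0 // subr_ge0 ltW.
(* For l <= f z, semicontinuity points the wrong way. Instead compare with w = z at an iterate so
   close to z that the quadratic term is at most e. *)
apply/lee_addgt0Pr => e e0.
have eC : 0 < e / ((t + L + Lh) / 2) by rewrite divr_gt0.
have d0 : 0 < Num.sqrt (e / ((t + L + Lh) / 2)) by rewrite sqrtr_gt0.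
have [k _ xk] := visit _ 0%N (near_norm2_lt z d0).
apply: (@le_trans _ _ (F k.+1)%:E); first by rewrite lee_fin.
rewrite -FE; apply: le_trans (le_trans (GPPA_descent k z) _).
  by rewrite leeDl // lee_fin mulr_ge0 // sqr_ge0.
rewrite leeD2l // lee_fin mulrC -ler_pdivlMr // -[leRHS]sqr_sqrtr ?(ltW eC) //.
by rewrite ler_pXn2r ?nnegrE ?norm2_ge0 ?sqrtr_ge0 // norm2_distC ltW.
Qed.

(** The optimality subgradients of g1 at x_{k+1} tend to grad h - grad g2 at the limit, because the
    steps vanish and the gradients are continuous. *)
Lemma GPPA_cvg_critical xs : x @ \oo --> xs -> critical_point g1 g2 h xs.
Proof.
move=> x_cvg; have [l [F_cvg _ f_cluster]] := GPPA_value_cvg.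
have fxs : f xs = l%:E.
  apply: f_cluster => A B xA xB.
  exact: filter_ex (filterI xA (x_cvg _ xB)).
have x1_cvg : x k.+1 @[k --> \oo] --> xs by rewrite cvg_shiftS.
have gxc : grad g2 (x k) @[k --> \oo] --> grad g2 xs.
  have g2c := lipschitz2_continuous g2_lip; exact: cvg_comp x_cvg (g2c xs).
have hxc : grad h (x k) @[k --> \oo] --> grad h xs.
  have hc := lipschitz2_continuous h_lip; exact: cvg_comp x_cvg (hc xs).
split; first by rewrite /effdom /= fxs ltry.
have g1xs : g1 xs = (l - g2 xs + h xs)%:E.
  move: fxs; rewrite /dc_fun; case: (g1 xs) => [b||] //= [<-].
  by congr EFin; lra.
exists (grad h xs); split.
  exists (grad h xs - grad g2 xs); last by rewrite subrK.
  split; first by rewrite /effdom /= g1xs ltry.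
  exists (fun k => x k.+1), (fun k =>
    - (t *: (x k.+1 - x k) + (grad g2 (x k) - grad h (x k)))); split => //.
  (* g1 need not be continuous: its values converge because those of f tend to l = f xs and g2, h
     are continuous. *)
  - rewrite g1xs.
    rewrite (_ : (fun k => _) = EFin \o
        (fun k => fine (f (x k.+1)) - g2 (x k.+1) + h (x k.+1))); last first.
      apply/funext => k /=; rewrite dc_fun_EFin ?GPPA_fin_num //=.
      by rewrite -{1}(fineK (GPPA_fin_num k.+1)); congr EFin; lra.
    apply: cvg_EFin; first by apply: nearW.
    apply: cvgD; first apply: cvgB.
    + by rewrite (cvg_shiftS (fun k => fine (f (x k)))).
    + exact: cvg_comp x1_cvg (differentiable_continuous (g2_diff xs)).
    + exact: cvg_comp x1_cvg (differentiable_continuous (h_diff xs)).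
  - by move=> k; exact: GPPA_frechet_g1.
  - have -> : grad h xs - grad g2 xs =
        - (t *: (xs - xs) + (grad g2 xs - grad h xs)).
      by rewrite subrr scaler0 add0r opprB.
    apply: cvgN; apply: cvgD; last exact: cvgB.
    by apply: cvgZ; [exact: cvg_cst|exact: cvgB].
move=> z; apply: (ler_cvg_to (a := \oo)
  (f := fun k => dotv (grad h (x k)) (z - x k)) (g := fun k => h z - h (x k))).
- exact: (cvg_dotv hxc (cvgB (cvg_cst z) x_cvg)).
- apply: cvgB; first exact: cvg_cst.
  exact: cvg_comp x_cvg (differentiable_continuous (h_diff xs)).
- by apply: nearW => k; exact: GPPA_subdiff.
Qed.

Lemma GPPA_KL_cvg xs : KL_property f xs -> cluster (x @ \oo) xs ->
  x @ \oo --> xs.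
Proof.
move=> [_ [nu [U [phi [nu0 xU phiP KL]]]]] x_cluster.
have [l [F_cvg F_ge /(_ xs x_cluster) fxs]] := GPPA_value_cvg.
pose F k := fine (f (x k)).
have FE k : f (x k) = (F k)%:E by rewrite fineK // dc_fun_EFin ?GPPA_fin_num.
have [r r0 rU] := nbhs_norm2 xU.
have [L0 _] := g2_lip; have [Lh0 _] := h_lip; have t0 := t_gt0.
apply: (@kl_cvg _ _ x xs (fun k => F k - l) ((t - L) / 2) (t + L + Lh) nu r phi)
  => //.
- by rewrite divr_gt0 // subr_gt0.
- by lra.
- by move=> k; rewrite subr_ge0; exact: F_ge.
- by rewrite -(subrr l); apply: cvgB => //; exact: cvg_cst.
- move=> k; have := GPPA_descent k (x k).
  by rewrite subrr norm2_0 expr0n mulr0 adde0 !FE lee_fin; lra.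
move=> k /rU xk /andP[s0 snu].
have := KL (x k.+1) xk; rewrite fxs FE -EFinD !lte_fin -EFinB /=.
rewrite -subr_gt0 s0 -ltrBlDl snu => /(_ isT isT).
have [v fv vD] := GPPA_subgradient k.
have phi_gt0 : 0 < phi^`()%classic (F k.+1 - l).
  by case: phiP => _ _ _ _ /(_ (F k.+1 - l)) []//; rewrite in_itv /= s0.
rewrite -lee_fin => /le_trans; apply; rewrite EFinM lee_pmul2l ?lte_fin //.
(* The distance to the subdifferential is at most the norm of the particular subgradient v. *)
apply: (@le_trans _ _ (norm2 v)%:E); last by rewrite lee_fin.
by apply: ereal_inf_lbound; exists v.
Qed.

End GPPA.

Theorem theorem3p8 (R : realType) (n : nat)
    (g1 : 'rV[R]_n -> \bar R) (g2 h : 'rV[R]_n -> R) (L Lh t : R)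
    (x : nat -> 'rV[R]_n)
    (g1_proper : proper_efun g1) (g1_lsc : lower_semicontinuous g1)
    (g2_diff : forall z, differentiable g2 z)
    (g2_lip : lipschitz2 L (grad g2))
    (h_convex : convex_function setT h)
    (f_inf : (-oo < ereal_inf (range (dc_fun g1 g2 h)))%E)
    (f_lsc : lower_semicontinuous (dc_fun g1 g2 h))
    (h_diff : forall z, differentiable h z)
    (h_lip : lipschitz2 Lh (grad h))
    (f_KL : forall z, effdom (dc_fun g1 g2 h) z -> KL_property (dc_fun g1 g2 h) z)
    (tL : L < t) (x_GPPA : GPPA g1 g2 h t x)
    (x_cluster : cluster (x @ \oo) !=set0) :
  exists2 xbar, x @ \oo --> xbar & critical_point g1 g2 h xbar.
Proof.
have [xs xs_cluster] := x_cluster.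
have [l [_ _ f_cluster]] :=
  GPPA_value_cvg g1_proper g2_diff g2_lip h_diff h_lip tL x_GPPA f_inf f_lsc.
(* The cluster point lies in the domain because f takes the finite limit value there. *)
have KL : KL_property (dc_fun g1 g2 h) xs.
  by apply: f_KL; rewrite /effdom /= (f_cluster _ xs_cluster) ltry.
have x_cvg : x @ \oo --> xs.
  exact: (GPPA_KL_cvg g1_proper g2_diff g2_lip h_diff h_lip tL x_GPPA).
exists xs => //.
exact: (GPPA_cvg_critical g1_proper g2_diff g2_lip h_diff h_lip tL x_GPPA).
Qed.
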